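(* Let $\beta=\frac{1+\sqrt5}2$. The set of $F$-expansions of minimal weight in $\{-1,0,1\}^*$ is equal to the set of $\beta$-expansions of minimal weight in $\{-1,0,1\}^*$.
   Context: Fibonacci numbers: $F_0=1$, $F_1=2$, $F_n=F_{n-1}+F_{n-2}$ for $n\ge2$. For words $x=x_1\cdots x_n$, $y=y_1\cdots y_m$ over $\mathbb Z$, $x\sim_F y$ means $\sum_{j=1}^n x_jF_{n-j}=\sum_{j=1}^m y_jF_{m-j}$. The weight is $\|x\|=\sum_j|x_j|$. $x$ is $F$-heavy if there is $y\in\mathbb Z^*$ with $x\sim_F y$ and $\|y\|<\|x\|$; otherwise $x$ is an $F$-expansion of minimal weight. Similarly, $x\sim_\beta y$ means $\sum_j x_j\beta^{-j}=\beta^k\sum_j y_j\beta^{-j}$ for some $k\in\mathbb Z$, $x$ is $\beta$-heavy if some $y\in\mathbb Z^*$ with $x\sim_\beta y$ has $\|y\|<\|x\|$, and otherwise $x$ is a $\beta$-expansion of minimal weight. *)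

(* Defs.v *)
(* MathComp, with the type of real numbers of MathComp-Analysis. *)
From mathcomp Require Import all_boot all_order all_algebra.
From mathcomp Require Import classical_sets reals.

Set Implicit Arguments.
Unset Strict Implicit.
Unset Printing Implicit Defensive.

Import Order.TTheory GRing.Theory Num.Theory.
Local Open Scope ring_scope.

(* Words are 0-indexed, so the letter x_j (1 <= j <= n) of the mathematical
   text is the entry x`_(j - 1), and x`_i goes with F_(n - (i + 1)) and with
   beta^-(i + 1). *)
Definition word := seq int.

Fixpoint F (n : nat) : nat :=
  match n with
  | 0 => 1
  | S m => match m with 0 => 2 | S k => F m + F k end
  end%N.

Definition F_value (x : word) : int :=
  \sum_(i < size x) x`_i * (F (size x - i.+1))%:Z.

Definition F_equiv (x y : word) : Prop := F_value x = F_value y.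

Definition golden_ratio (R : realType) : R := (1 + Num.sqrt 5) / 2.

Definition beta_value (R : realType) (beta : R) (x : word) : R :=
  \sum_(i < size x) (x`_i)%:~R * beta ^- i.+1.

(* The exponent k : int ranges over all integers, negative ones included. *)
Definition beta_equiv (R : realType) (beta : R) (x y : word) : Prop :=
  exists k : int, beta_value beta x = beta ^ k * beta_value beta y.

Definition weight (x : word) : nat := (\sum_(a <- x) `|a|)%N.

Definition heavy (sim : word -> word -> Prop) (x : word) : Prop :=
  exists y : word, sim x y /\ (weight y < weight x)%N.

Definition minimal_weight (sim : word -> word -> Prop) : set word :=
  [set x | ~ heavy sim x]%classic.

Definition signed_words : set word :=
  [set x | forall a : int, a \in x -> a \in [:: -1; 0; 1]]%classic.

(* Main.v *)
From mathcomp Require Import lra.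
Require Import Defs.
From mathcomp Require Import all_boot all_order all_algebra.
From mathcomp Require Import classical_sets reals.
From mathcomp Require Import zify.

Set Implicit Arguments.
Unset Strict Implicit.
Unset Printing Implicit Defensive.

Import Order.TTheory GRing.Theory Num.Theory.
Local Open Scope ring_scope.

(* A word x is identified with the polynomial p with x_n as constant
   coefficient.  Let phi be the golden ratio and psi = 1 - phi its conjugate.
   Since phi^i = F_i mod (2 - phi)Z, two words are F-equivalent if and only if
   p(phi) - q(phi) = t (2 - phi) for some integer t, and then
   p(psi) - q(psi) = t (phi + 1).  Here 2 - phi = phi^-2.

   F-minimal implies beta-minimal because phi^-k is congruent mod (2 - phi)Z to
   0 or to +-phi^j with j >= 0, so that negative powers of phi can be replaced
   by nonnegative ones at no cost.

   Conversely, let x be beta-minimal with digits in {-1,0,1} and let y be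
   F-minimal and F-equivalent to x; then y is beta-minimal too.  Local exchanges
   show that the digits of beta-minimal words are sparse, which bounds the
   conjugates: |x(psi)| < phi and |y(psi)| < phi + 1.  Hence |t| <= 1. If t = 1,
   then either y(phi) + phi^-2 can be rewritten with weight at most that of y
   (constant digit negative, or next digit at least 2), or y(psi) > -1, which
   contradicts x(psi) < phi. *)

(** * Evaluation of integer polynomials *)

Definition eval (R : comNzRingType) (r : R) (p : {poly int}) : R :=
  (map_poly intr p).[r].

Section Eval.
Variables (R : comNzRingType) (r : R).
Implicit Types p q : {poly int}.

Lemma evalD p q : eval r (p + q) = eval r p + eval r q.
Proof. by rewrite /eval rmorphD hornerD. Qed.

Lemma evalN p : eval r (- p) = - eval r p.
Proof. by rewrite /eval rmorphN hornerN. Qed.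

Lemma evalB p q : eval r (p - q) = eval r p - eval r q.
Proof. by rewrite evalD evalN. Qed.

Lemma evalM p q : eval r (p * q) = eval r p * eval r q.
Proof. by rewrite /eval rmorphM hornerM. Qed.

Lemma evalXn n : eval r 'X^n = r ^+ n.
Proof. by rewrite /eval map_polyXn hornerXn. Qed.

Lemma evalMXn p n : eval r (p * 'X^n) = eval r p * r ^+ n.
Proof. by rewrite evalM evalXn. Qed.

Lemma evalZ (a : int) p : eval r (a *: p) = a%:~R * eval r p.
Proof. by rewrite /eval map_polyZ hornerZ. Qed.

Lemma eval0 : eval r 0 = 0.
Proof. by rewrite /eval rmorph0 horner0. Qed.

Lemma eval_sum (I : Type) (s : seq I) (P : pred I) (f : I -> {poly int}) :
  eval r (\sum_(i <- s | P i) f i) = \sum_(i <- s | P i) eval r (f i).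
Proof. exact: (big_morph (eval r) evalD eval0). Qed.

Lemma eval_Poly (s : seq int) :
  eval r (Poly s) = horner_rec [seq a%:~R | a <- s] r.
Proof. by rewrite /eval map_Poly horner_Poly. Qed.

Lemma eval_coef p : eval r p = \sum_(i < size p) (p`_i)%:~R * r ^+ i.
Proof.
rewrite -[in LHS](coefK p) poly_def eval_sum.
by apply: eq_bigr => i _; rewrite evalZ evalXn.
Qed.

Lemma eval_drop p n :
  eval r (drop_poly n p) = (p`_n)%:~R + r * eval r (drop_poly n.+1 p).
Proof.
have -> : drop_poly n p = (p`_n)%:P + drop_poly n.+1 p * 'X^1.
  apply/polyP => -[|i]; rewrite !coefE /= ?addr0 //.
  by rewrite add0r subn1 /= addSnnS.
by rewrite evalD evalM evalXn expr1 mulrC {1}/eval map_polyC hornerC.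
Qed.

End Eval.

(** Equality in the triangle inequality: [b] lies between 0 and [a], so taking [b] off the digit [a]
    saves exactly [|b|] of weight. *)
Definition dominates (a b : int) : Prop :=
  (absz (a - b) + absz b = absz a)%N.

Lemma dominates0 a : dominates a 0.
Proof. by rewrite /dominates; lia. Qed.

(** * Weight of polynomials *)

Section Weight.
Implicit Types p q : {poly int}.

Lemma weight_widen (s : seq int) n :
  (size s <= n)%N -> weight s = (\sum_(i < n) `|nth 0%R s i|)%N.
Proof.
move=> sn; rewrite /weight (big_nth 0) 
  -(big_mkord xpredT (fun i => absz (nth 0 s i))).
rewrite (big_cat_nat (n := size s) _ sn) //= -[LHS]addn0; congr (_ + _)%N.
rewrite big_nat_cond big1 // => i /andP[/andP[si _] _].
by rewrite nth_default.
Qed.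

Lemma weight_Poly (s : seq int) : weight (Poly s) = weight s.
Proof.
rewrite (weight_widen (size_Poly s)) (weight_widen (leqnn (size s))).
by apply: eq_bigr => i _; rewrite coef_Poly.
Qed.

Lemma weight_add p q : (weight (p + q)%R <= weight p + weight q)%N.
Proof.
pose n := maxn (size p) (size q).
rewrite (weight_widen (size_polyD p q)) (@weight_widen p n) ?leq_maxl //.
rewrite (@weight_widen q n) ?leq_maxr // -big_split /=.
apply: leq_sum => i _; rewrite coefD.  move: (p`_i) (q`_i) => a b; lia.
Qed.

Lemma weight_sub p q :
  (forall i, dominates p`_i q`_i) ->
  (weight (p - q)%R + weight q = weight p)%N.
Proof.
move=> h; pose n := maxn (size p) (size q).
have pq : (size (p - q)%R <= n)%N.
  by rewrite (leq_trans (size_polyD p (- q))) // size_polyN.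
rewrite (weight_widen pq) (@weight_widen p n) ?leq_maxl //.
rewrite (@weight_widen q n) ?leq_maxr // -big_split /=.
by apply: eq_bigr => i _; rewrite coefB; exact: h.
Qed.

Lemma weightZ (a : int) p : (weight (a *: p)%R = `|a| * weight p)%N.
Proof.
rewrite (@weight_widen (a *: p)%R (size p)) ?size_scale_leq //.
rewrite (weight_widen (leqnn (size p))) big_distrr /=.
by apply: eq_bigr => i _; rewrite coefZ abszM.
Qed.

Lemma weightN p : weight (- p) = weight p.
Proof. by rewrite -scaleN1r weightZ mul1n. Qed.

Lemma weight_mulXn p n : weight (p * 'X^n) = weight p.
Proof.
have [->|p0] := eqVneq p 0; first by rewrite mul0r.
rewrite polyseqMXn // /weight -cat_nseq big_cat /= big1_seq ?add0n // => a.
by rewrite mem_nseq => /andP[_ /andP[_ /eqP->]].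
Qed.

Lemma weight_Xn n : weight ('X^n : {poly int}) = 1%N.
Proof.
by rewrite -['X^n]mul1r weight_mulXn polyseq1 /weight big_seq1.
Qed.

End Weight.

(* Closes the seven conditions of a weight-lowering exchange: five on digits, one on values (by
   [lra], with the powers of phi in context), one on weights. *)
Tactic Notation "exchange" uconstr(E) :=
  refine (E _ _ _ _ _ _ _);
  [ rewrite /dominates; lia | rewrite /dominates; lia | rewrite /dominates; lia
  | rewrite /dominates; lia | rewrite /dominates; lia
  | rewrite !eval_Poly /=; lra | by rewrite /weight !big_cons !big_nil ].

(** * Beta-minimal polynomials and local exchanges *)

Section Golden.
Variable R : realType.
Notation phi := (golden_ratio R).
Implicit Types p q : {poly int}.

Lemma golden_sqr : phi * phi = phi + 1.
Proof.
have := sqr_sqrtr (ler0n R 5); rewrite expr2 /golden_ratio.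
by move: (Num.sqrt _) => s hs; lra.
Qed.

Lemma golden_exp n : phi ^+ n.+2 = phi ^+ n.+1 + phi ^+ n.
Proof. by rewrite 2!exprS mulrA golden_sqr mulrDl mul1r -exprS. Qed.

Lemma golden_powers :
  [/\ phi ^+ 2 = phi + 1, phi ^+ 3 = 2 * phi + 1, phi ^+ 4 = 3 * phi + 2,
      phi ^+ 5 = 5 * phi + 3 &
      phi ^+ 6 = 8 * phi + 5 /\ phi ^+ 7 = 13 * phi + 8].
Proof. by rewrite !golden_exp !expr1 !expr0; do !split; lra. Qed.

Lemma golden_bounds : 8 / 5 < phi < 13 / 8.
Proof.
have h := golden_sqr; have s0 : 0 <= Num.sqrt 5 :> R := sqrtr_ge0 _.
have p0 : 0 < phi by rewrite /golden_ratio; lra.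
by apply/andP; split; nra.
Qed.

Lemma golden_neq0 : phi != 0.
Proof. by have /andP[h _] := golden_bounds; apply/eqP => h0; lra. Qed.

(** Two natural exponents replace the integer exponent of [beta_equiv], which keeps negative powers
    of phi out of the argument. *)
Definition beta_min p := forall q (m n : nat),
  eval phi q * phi ^+ m = eval phi p * phi ^+ n -> (weight p <= weight q)%N.

Lemma beta_minN p : beta_min p -> beta_min (- p).
Proof.
move=> hp q m n; rewrite evalN mulNr => /eqP.
rewrite -eqr_oppLR -mulNr -evalN => /eqP /hp.
by rewrite !weightN.
Qed.

(* The factor phi^2 allows the replacement r to reach two positions below the
   removed block s. *)
Lemma beta_min_exchange p i (s r : seq int) :
  beta_min p ->
  (forall k, dominates p`_(i + k) s`_k) ->
  eval phi (Poly r) = phi ^+ 2 * eval phi (Poly s) ->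
  (weight s <= weight r)%N.
Proof.
move=> hp hs hr.
pose c := Poly s * 'X^i.
have hc : (weight (p - c)%R + weight c = weight p)%N.
  apply: weight_sub => j; rewrite coefMXn coef_Poly.
  case: ltnP => [_|ij]; first exact: dominates0.
  by have := hs (j - i)%N; rewrite subnKC.
have /hp : eval phi ((p - c) * 'X^2 + Poly r * 'X^i) * phi ^+ 0
    = eval phi p * phi ^+ 2.
  rewrite evalD !evalMXn evalB evalMXn hr expr0.
  by move: (phi ^+ i) (eval _ p) (eval _ (Poly s)) => z u v; lra.
rewrite -hc => h; have := leq_trans h (weight_add _ _).
by rewrite [weight c]weight_mulXn !weight_mulXn !weight_Poly leq_add2l.
Qed.

(** Only positive digits are constrained here; [sparse] covers the negative ones through [- p]. *)
Definition sparse_at (p : {poly int}) i : Prop :=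
  0 < p`_i -> [/\ p`_i.+1 = 0, 0 <= p`_i.+2, p`_i <= 2 &
    0 < p`_i.+2 -> [/\ p`_i = 1, p`_i.+2 = 1 & p`_i.+4 = 0]].

Definition sparse p := forall i, sparse_at p i /\ sparse_at (- p) i.

(** If a condition failed, an identity between powers of phi would replace a few digits by strictly
    lighter ones. The entries of [r] start two positions below [i]. *)
Lemma beta_min_sparse_at p i : beta_min p -> sparse_at p i.
Proof.
move=> hp pi.
have E (k0 k1 k2 k3 k4 : int) r :
    dominates p`_i k0 -> dominates p`_i.+1 k1 -> dominates p`_i.+2 k2 ->
    dominates p`_i.+3 k3 -> dominates p`_i.+4 k4 ->
    eval phi (Poly r) = phi ^+ 2 * eval phi (Poly [:: k0; k1; k2; k3; k4]) ->
    (weight r < weight [:: k0; k1; k2; k3; k4])%N -> False.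
  move=> h0 h1 h2 h3 h4 hr; rewrite ltnNge => /negP; apply.
  apply: (@beta_min_exchange p i) => // -[|[|[|[|[|k]]]]] /=;
    rewrite ?addn0 ?addn1 ?addn2 ?addn3 ?addn4 //.
  by rewrite nth_nil; exact: dominates0.
have [g2 g3 g4 g5 [g6 g7]] := golden_powers.
(* 1 + phi = phi^2 and 1 - phi = - phi^-1. *)
have n1 : p`_i.+1 = 0.
  case: (ltrgt0P p`_i.+1) => // h; exfalso.
    by exchange (E 1 1 0 0 0 [:: 0; 0; 0; 0; 1]).
  by exchange (E 1 (-1) 0 0 0 [:: 0; -1]).
(* 1 - phi^2 = - phi. *)
have n2 : 0 <= p`_i.+2.
  case: (lerP 0 p`_i.+2) => // h; exfalso.
  by exchange (E 1 0 (-1) 0 0 [:: 0; 0; 0; -1]).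
(* 3 = phi^2 + phi^-2. *)
have n0 : p`_i <= 2.
  case: (lerP p`_i 2) => // h; exfalso.
  by exchange (E 3 0 0 0 0 [:: 1; 0; 0; 0; 1]).
(* In order: 2 + phi^2 = phi^3 + phi^-2, 1 + 2 phi^2 = phi^4 - phi^-1, 1 + phi^2 + phi^4 = phi^5 -
   phi^-1 and phi^2 - phi^4 = - phi^3. *)
split=> // h2; split.
- have [h|h] : p`_i = 1 \/ 2 <= p`_i by move: (p`_i) pi => a; lia.
    by [].
  by exfalso; exchange (E 2 0 1 0 0 [:: 1; 0; 0; 0; 0; 1]).
- have [h|h] : p`_i.+2 = 1 \/ 2 <= p`_i.+2 by move: (p`_i.+2) h2 => a; lia.
    by [].
  by exfalso; exchange (E 1 0 2 0 0 [:: 0; -1; 0; 0; 0; 0; 1]).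
case: (ltrgt0P p`_i.+4) => // h; exfalso.
  by exchange (E 1 0 1 0 1 [:: 0; -1; 0; 0; 0; 0; 0; 1]).
by exchange (E 0 0 1 0 (-1) [:: 0; 0; 0; 0; 0; -1]).
Qed.

Lemma beta_min_sparse p : beta_min p -> sparse p.
Proof.
move=> hp i; split; first exact: beta_min_sparse_at.
exact: beta_min_sparse_at (beta_minN hp).
Qed.

Lemma sparseN p : sparse p -> sparse (- p).
Proof. by move=> sp i; rewrite opprK; have [] := sp i. Qed.

Lemma sparse_drop p n : sparse p -> sparse (drop_poly n p).
Proof.
move=> sp i; have [] := sp (i + n)%N; rewrite /sparse_at !coefN.
by rewrite !coef_drop_poly.
Qed.

(** Lets [lra] reduce products with powers of phi to combinations of [phi * d] and [d], which it
    treats as atoms. *)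
Lemma mulr_golden_powers (d : R) :
  [/\ phi ^+ 2 * d = (phi + 1) * d, phi ^+ 3 * d = (2 * phi + 1) * d,
      phi ^+ 4 * d = (3 * phi + 2) * d, phi ^+ 5 * d = (5 * phi + 3) * d &
      phi ^+ 6 * d = (8 * phi + 5) * d].
Proof. by have [-> -> -> -> [-> _]] := golden_powers. Qed.

End Golden.

(** * Conjugate values of sparse polynomials *)

Section Conjugate.
Variable R : realType.
Implicit Types p q : {poly int}.
Notation phi := (golden_ratio R).
Notation psi := (1 - phi).

Lemma conj_sqr : psi * psi = psi + 1.
Proof. by have := golden_sqr R; lra. Qed.

Lemma eval_drop0 p : eval psi p = (p`_0)%:~R + psi * eval psi (drop_poly 1 p).
Proof. by rewrite -eval_drop drop_poly0l. Qed.

Lemma scale_bound (a B d : R) :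
  0 < a -> - B < d < B -> - (a * B) < a * d < a * B.
Proof. by move=> a0; rewrite -mulrN !ltr_pM2l. Qed.

(** Induction on the size: split off a block of low digits and apply the bound B to the rest, which
    is scaled by a power of psi. For m = 2 the estimate is tight, as B = 2 + |psi|^3 B; strictness
    comes from the strict bound on the rest. *)
Lemma conj_bound (m : int) p : (m == 1) || (m == 2) ->
  sparse p -> (forall i, - m <= p`_i <= m) ->
  - (phi + m%:~R - 1) < eval psi p < phi + m%:~R - 1.
Proof.
move=> hm; have /andP[b1 b2] := golden_bounds R; have g := golden_sqr R.
set B := phi + m%:~R - 1.
have m12 : m%:~R = 1 :> R \/ m%:~R = 2 :> R.
  by case/orP: hm => /eqP->; [left|right].
have B0 : 0 < B by rewrite /B; case: m12 => ->; lra.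
have flip x : (- B < - x < B) = (- B < x < B).
  by rewrite ltrN2 ltrNl andbC.
have pos q : (forall k, - B < eval psi (drop_poly k.+1 q) < B) ->
    sparse q -> q`_0 <= m -> 0 < q`_0 -> - B < eval psi q < B.
  move=> hd sq qm q0; have [/(_ q0)[q1 q2 _ q02] _] := sq 0%N.
  have le_m : (q`_0)%:~R <= m%:~R :> R by rewrite ler_int.
  have ge_1 : 1 <= (q`_0)%:~R :> R by rewrite -[1](mulr1z 1) ler_int; lia.
  (* The low block is (q_0, 0, 0), and psi^3 = - (2 phi - 3). *)
  have [q20|q20] := eqVneq q`_2 0.
    have := hd 2; have -> : eval psi q =
        (q`_0)%:~R - (2 * phi - 3) * eval psi (drop_poly 3 q).
      rewrite eval_drop0 2!eval_drop q1 q20; move: (eval _ _) => d.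
      by have [g2 g3 _ _ _] := mulr_golden_powers d; lra.
    move=> /(@scale_bound (2 * phi - 3)) h.
    have /andP[] : - ((2 * phi - 3) * B) <
        (2 * phi - 3) * eval psi (drop_poly 3 q) < (2 * phi - 3) * B.
      by apply: h; lra.
    move: ((2 * phi - 3) * eval psi (drop_poly 3 q)) le_m ge_1 => d.
    by rewrite /B; case: m12 => -> *; apply/andP; split; lra.
  (* The low block is (1, 0, 1, 0, 0), with value 1 + psi^2 = 3 - phi, and psi^5 = - (5 phi - 8). *)
  have q2p : 0 < q`_2 by rewrite lt_neqAle eq_sym q20.
  have [q0e q2e q4e] := q02 q2p.
  have [/(_ q2p)[q3e _ _ _] _] := sq 2.
  have := hd 4; have -> : eval psi q =
      3 - phi - (5 * phi - 8) * eval psi (drop_poly 5 q).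
    rewrite eval_drop0 4!eval_drop q1 q0e q2e q3e q4e.
    move: (eval _ _) => d.
    by have [g2 g3 g4 g5 _] := mulr_golden_powers d; lra.
  move=> /(@scale_bound (5 * phi - 8)) h.
  have /andP[] : - ((5 * phi - 8) * B) <
      (5 * phi - 8) * eval psi (drop_poly 5 q) < (5 * phi - 8) * B.
    by apply: h; lra.
  move: ((5 * phi - 8) * eval psi (drop_poly 5 q)) => d.
  by rewrite /B; case: m12 => -> *; apply/andP; split; lra.
have [n] := ubnP (size p); elim: n p => // n IH p sz sp hp.
have hd k : - B < eval psi (drop_poly k.+1 p) < B.
  have [->|p0] := eqVneq p 0.
    by rewrite drop_poly0r eval0; apply/andP; split; lra.
  apply: IH; [|exact: sparse_drop|by move=> i; rewrite coef_drop_poly].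
  rewrite size_drop_poly; rewrite -size_poly_gt0 in p0.
  by apply: leq_trans (sz : (size p <= n)%N); rewrite ltn_subrL.
have /andP[hp1 hp2] := hp 0%N.
case: (ltrgt0P p`_0) => h.
- exact: pos.
- rewrite -[p]opprK evalN flip; apply: pos.
  + by move=> k; rewrite -scaleN1r drop_polyZ scaleN1r evalN flip.
  + exact: sparseN.
  + by rewrite coefN; move: (p`_0) hp1 => a; lia.
  + by rewrite coefN oppr_gt0.
rewrite eval_drop0 h add0r.
have := hd 0%N; move: (eval _ _) => d /(@scale_bound (phi - 1)) hh.
have /andP[h1 h2] : - ((phi - 1) * B) < (phi - 1) * d < (phi - 1) * B.
  by apply: hh; lra.
move: h1 h2; rewrite /B; case: m12 => -> h1 h2.
  by apply/andP; split; lra.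
by apply/andP; split; lra.
Qed.

Lemma sparse_conj_bound p :
  sparse p -> - (phi + 1) < eval psi p < phi + 1.
Proof.
move=> sp; have -> : phi + 1 = phi + 2%:~R - 1.
  by rewrite (_ : 2%:~R = 2) //; lra.
apply: conj_bound => // i; have [] := sp i; rewrite /sparse_at coefN.
move: (p`_i) => a; case: (ltrgt0P a) => [a0 /(_ isT)[_ _ a2 _] _|a0 _|->//].
  by lia.
by rewrite oppr_gt0 => /(_ a0)[_ _ a2 _]; lia.
Qed.

(** The digits from position 2 on contribute more than -1, because psi^2 (phi + 1) = 1. So the two
    lowest digits can do harm only if they are 0 and 1, and then sparseness determines enough of the
    next digits. *)
Lemma eval_conj_gt p : sparse p -> 0 <= p`_0 -> p`_1 <= 1 -> - 1 < eval psi p.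
Proof.
move=> sp p0 p1; have /andP[b1 b2] := golden_bounds R; have g := golden_sqr R.
have bd k : - (phi + 1) < eval psi (drop_poly k p) < phi + 1.
  exact/sparse_conj_bound/sparse_drop.
have d2 : -1 < (2 - phi) * eval psi (drop_poly 2 p).
  have := bd 2; move: (eval _ _) => d /(@scale_bound (2 - phi)) h.
  have /andP[h1 _] := h ltac:(lra).
  by lra.
have e2 : eval psi p =
    (p`_0)%:~R + psi * (p`_1)%:~R + (2 - phi) * eval psi (drop_poly 2 p).
  rewrite eval_drop0 eval_drop; move: (eval _ _) => d.
  by have [g2 _ _ _ _] := mulr_golden_powers d; lra.
have p0R : 0 <= (p`_0)%:~R :> R by rewrite ler0z.
have [sp0 _] := sp 0%N; have [sp1 _] := sp 1%N; have [sp3 _] := sp 3.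
have [p00|p0n] := eqVneq p`_0 0; last first.
  have p0p : 0 < p`_0 by rewrite lt_neqAle eq_sym p0n.
  have [p10 _ _ _] := sp0 p0p.
  by rewrite e2 p10 mulr0 addr0; lra.
have [p1le|p1gt] := lerP p`_1 0.
  have p1R : (p`_1)%:~R <= 0 :> R by rewrite lerz0.
  have : 0 <= psi * (p`_1)%:~R by rewrite mulr_le0 //; lra.
  by rewrite e2; lra.
have p11 : p`_1 = 1 by move: (p`_1) p1 p1gt => a; lia.
have [p2 p3 _ p13] := sp1 p1gt.
(* Here 5 - 3 phi = psi^4, and the limiting value is psi - psi^4 (phi + 1) = psi - psi^2 = -1. *)
have [p30|p3n] := eqVneq p`_3 0.
  have := bd 4; have -> : eval psi p =
      psi + (5 - 3 * phi) * eval psi (drop_poly 4 p).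
    rewrite eval_drop0 3!eval_drop p00 p11 p2 p30; move: (eval _ _) => d.
    by have [g2 g3 g4 _ _] := mulr_golden_powers d; lra.
  move: (eval _ _) => d /(@scale_bound (5 - 3 * phi)) h.
  by have /andP[h1 _] := h ltac:(lra); lra.
have p3p : 0 < p`_3 by rewrite lt_neqAle eq_sym p3n.
have [_ p31 p50] := p13 p3p.
have [p4 _ _ _] := sp3 p3p.
(* Here 4 - 3 phi = psi + psi^3 and 13 - 8 phi = psi^6; the limiting value psi + psi^3 - psi^4 is
   again -1. *)
have := bd 6; have -> : eval psi p =
    4 - 3 * phi + (13 - 8 * phi) * eval psi (drop_poly 6 p).
  rewrite eval_drop0 5!eval_drop p00 p11 p2 p31 p4 p50; move: (eval _ _) => d.
  have [_ g3 _ _ _] := golden_powers R.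
  by have [g2 g3' g4 g5 g6] := mulr_golden_powers d; lra.
move: (eval _ _) => d /(@scale_bound (13 - 8 * phi)) h.
by have /andP[h1 _] := h ltac:(lra); lra.
Qed.

End Conjugate.

(** * Fibonacci values and congruence modulo 2 - phi *)

Definition F_eval (p : {poly int}) : int := \sum_(i < size p) p`_i * (F i)%:Z.

Lemma sum_coef_widen (V : pzRingType) (f : int -> V) (g : nat -> V)
    (s : seq int) n :
  f 0 = 0 -> (size s <= n)%N ->
  \sum_(i < size s) f s`_i * g i = \sum_(i < n) f s`_i * g i.
Proof.
move=> f0 sn; rewrite (big_ord_widen n (fun i => f s`_i * g i)) // big_mkcond.
apply: eq_bigr => i _; case: ltnP => // si.
by rewrite nth_default // f0 mul0r.
Qed.

(** Common to both kinds of value: reversal makes the last letter the constant coefficient. [Poly]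
    drops only zeros, which contribute nothing since [f 0 = 0]. *)
Lemma sum_coef_rev (V : pzRingType) (f : int -> V) (g : nat -> V)
    (x : seq int) :
  f 0 = 0 ->
  \sum_(i < size x) f x`_i * g (size x - i.+1)%N
    = \sum_(i < size (Poly (rev x))) f (Poly (rev x))`_i * g i.
Proof.
move=> f0; have sn : (size (Poly (rev x)) <= size x)%N.
  by rewrite (leq_trans (size_Poly _)) ?size_rev.
rewrite (sum_coef_widen _ f0 sn) (reindex_inj rev_ord_inj) /=.
apply: eq_bigr => i _; rewrite coef_Poly nth_rev // subnSK // subKn //.
exact: ltnW.
Qed.

Lemma F_value_eval (x : word) : F_value x = F_eval (Poly (rev x)).
Proof. exact: (@sum_coef_rev int id (fun i => (F i)%:Z)). Qed.

Lemma weight_Poly_rev (x : word) : weight (Poly (rev x)) = weight x.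
Proof. by rewrite weight_Poly /weight; apply: perm_big; rewrite perm_rev. Qed.

(** Otherwise the exponent of 5 would be even on the left and odd on the right. *)
Lemma sqr_eq_5sqr (m n : nat) : (n ^ 2 = 5 * m ^ 2)%N -> m = 0%N.
Proof.
move=> h; case: (posnP m) => // m0; exfalso.
have n0 : (0 < n)%N.
  by case: (posnP n) h => // ->; rewrite exp0n // => h; move: m0; case: m h.
have /(congr1 (logn 5)) := h.
by rewrite lognM ?expn_gt0 ?m0 // !lognX /= (_ : logn 5 5 = 1%N) //; lia.
Qed.

Section FibonacciCongruence.
Variable R : realType.
Implicit Types p q : {poly int}.
Notation phi := (golden_ratio R).
Notation psi := (1 - phi).

(** The factor 2 F_i - F_(i+1) is F_(i-2), written without negative indices. Leaving [r] general
    covers both phi and psi. *)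
Lemma expr_F (r : R) (i : nat) : r * r = r + 1 ->
  r ^+ i = (F i)%:R - (2 * (F i)%:R - (F i.+1)%:R) * (2 - r).
Proof.
move=> hr; suff [] : r ^+ i = (F i)%:R - (2 * (F i)%:R - (F i.+1)%:R) * (2 - r)
  /\ r ^+ i.+1 = (F i.+1)%:R - (2 * (F i.+1)%:R - (F i.+2)%:R) * (2 - r) by [].
elim: i => [|i [IH1 IH2]].
  by rewrite expr0 expr1 /=; split; lra.
split=> //.
have -> : r ^+ i.+2 = r ^+ i.+1 + r ^+ i.
  by rewrite 2!exprS mulrA hr mulrDl mul1r -exprS.
rewrite IH1 IH2 (_ : F i.+3 = (F i.+2 + F i.+1)%N) //
  (_ : F i.+2 = (F i.+1 + F i)%N) //.
rewrite !natrD; move: (F i)%:R (F i.+1)%:R => a b; lra.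
Qed.

(** The same [b] serves both roots; this links the difference at phi to the difference at psi. *)
Lemma eval_F_eval p : exists b : int, forall r : R, r * r = r + 1 ->
  eval r p = (F_eval p)%:~R - b%:~R * (2 - r).
Proof.
exists (\sum_(i < size p) p`_i * (2 * (F i)%:Z - (F i.+1)%:Z)) => r hr.
rewrite eval_coef /F_eval !rmorph_sum /= mulr_suml -sumrB.
apply: eq_bigr => i _; rewrite (expr_F i hr) !rmorphM rmorphB rmorphM /=.
rewrite !mulrz_nat -!pmulrn.
by move: (p`_i)%:~R (F i)%:R (F i.+1)%:R => c a b; lra.
Qed.

Lemma F_eval_eqP p q : F_eval p = F_eval q -> exists t : int,
  eval phi p = eval phi q + t%:~R * (2 - phi) :> R /\
  eval psi p = eval psi q + t%:~R * (phi + 1) :> R.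
Proof.
have [b hb] := eval_F_eval p; have [c hc] := eval_F_eval q.
have g := golden_sqr R; have g' := conj_sqr R.
move=> h; exists (c - b); rewrite !(hb, hc) // h rmorphB /=.
by move: (F_eval q)%:~R b%:~R c%:~R => x y z; split; lra.
Qed.

Lemma golden_irrational (a b : int) :
  a%:~R = b%:~R * (2 - phi) -> a = 0.
Proof.
move=> h; have g := golden_sqr R.
have : a%:~R * a%:~R - 3 * a%:~R * b%:~R + b%:~R * b%:~R = 0 :> R.
  (* the norm of a - b (2 - phi) *)
  have -> : 0 = (a%:~R - b%:~R * (2 - phi)) * (a%:~R - b%:~R * (2 - psi)) :> R.
    by rewrite h subrr mul0r.
  move: (a%:~R : R) (b%:~R : R) => x y.
  by have [g2 _ _ _ _] := mulr_golden_powers (y * y); lra.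
rewrite -(_ : 3%:~R = 3 :> R) // -!rmorphM -rmorphB -rmorphD /= => /eqP.
rewrite intr_eq0 => /eqP hab.
have b0 : absz b = 0%N.
  have sq5 : (absz (2 * a - 3 * b)%R ^ 2 = 5 * absz b ^ 2)%N.
    by rewrite -!mulnn; nia.
  exact: sqr_eq_5sqr sq5.
by nia.
Qed.

Lemma F_eval_eq p q (t : int) :
  eval phi p = eval phi q + t%:~R * (2 - phi) -> F_eval p = F_eval q.
Proof.
have [b hb] := eval_F_eval p; have [c hc] := eval_F_eval q.
have g := golden_sqr R; rewrite hb // hc // => h.
apply/eqP; rewrite -subr_eq0; apply/eqP.
apply: (@golden_irrational _ (b - c + t)); rewrite rmorphB rmorphD rmorphB /=.
by move: h; move: (F_eval p)%:~R (F_eval q)%:~R b%:~R c%:~R t%:~R => *; lra.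
Qed.

Lemma lucas_int n : exists b : int, phi ^+ n + psi ^+ n = b%:~R.
Proof.
have [b hb] := eval_F_eval 'X^n.
have g := golden_sqr R; have g' := conj_sqr R.
(* The traces of 1 and of 2 - phi are 2 and 3. *)
exists (2 * F_eval 'X^n - 3 * b).
rewrite -[phi ^+ n]evalXn -[psi ^+ n]evalXn !hb // rmorphB !rmorphM /=.
by rewrite (_ : 2%:~R = 2) // (_ : 3%:~R = 3) //; lra.
Qed.

End FibonacciCongruence.

(** * Comparison of the two notions of minimality *)

Definition F_min (p : {poly int}) : Prop :=
  forall q, F_eval q = F_eval p -> (weight p <= weight q)%N.

Section MinimalWeight.
Variable R : realType.
Implicit Types p q : {poly int}.
Notation phi := (golden_ratio R).
Notation psi := (1 - phi).

Lemma goldenV : phi^-1 = phi - 1.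
Proof.
apply: (mulIf (golden_neq0 R)); rewrite mulVf ?golden_neq0 //.
by have := golden_sqr R; lra.
Qed.

Lemma golden_negX k : exists m : {poly int}, (weight m <= 1)%N /\
  exists b : int, phi ^- k = eval phi m + b%:~R * (2 - phi).
Proof.
have g := golden_sqr R.
have w1 : weight ('X^0 : {poly int}) = 1%N by exact: weight_Xn.
(* For k = 0, 1, 2, 3 the powers phi^-k are 1, 1 - (2 - phi), 2 - phi and 1 - 2 (2 - phi). *)
case: k => [|[|[|[|k]]]].
- exists 'X^0; rewrite w1; split=> //; exists 0.
  by rewrite evalXn !expr0 invr1; lra.
- exists 'X^0; rewrite w1; split=> //; exists (-1).
  by rewrite evalXn expr0 expr1 goldenV; lra.
- exists 0; split; first by rewrite /weight polyseq0 big_nil.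
  by exists 1; rewrite eval0 -exprVn goldenV; lra.
- exists 'X^0; rewrite w1; split=> //; exists (-2).
  rewrite evalXn expr0 -exprVn goldenV.
  by have [_ g3 _ _ _] := golden_powers R; lra.
(* phi^-(k+2) = +-psi^(k+2) is +-phi^(k+2) up to an integer (a Lucas number);
   multiply by phi^-2 = 2 - phi. *)
have [L hL] := lucas_int R k.+2.
exists ((- (-1) ^+ k) *: 'X^k); split.
  by rewrite weightZ weight_Xn abszN abszX exp1n.
exists ((-1) ^+ k * L).
rewrite evalZ evalXn !rmorphM /= -hL rmorphN !rmorphXn /=.
have -> : psi = - phi^-1 by rewrite goldenV; lra.
rewrite [(- phi^-1) ^+ _]exprNn (_ : (-1) ^+ k.+2 = (-1) ^+ k :> R); last first.
  by rewrite 2!exprS !mulN1r opprK.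
have s2 : (-1) ^+ k * (-1) ^+ k = 1 :> R.
  by rewrite -exprD addnn -signr_odd odd_double.
rewrite (_ : (-1)%:~R = -1) // -exprVn.
have -> : phi^-1 ^+ k.+4 = (2 - phi) * phi^-1 ^+ k.+2.
  rewrite 2!exprS mulrA goldenV.
  by rewrite (_ : (phi - 1) * (phi - 1) = 2 - phi) //; lra.
have -> : phi ^+ k.+2 = (phi + 1) * phi ^+ k by rewrite 2!exprS mulrA g.
move: (phi^-1 ^+ k.+2) (phi ^+ k) ((-1) ^+ k : R) s2 => u v s s2.
have su : s * s * u = u by rewrite s2 mul1r.
have psu : phi * (s * s * u) = phi * u by rewrite su.
by have [g2 _ _ _ _] := mulr_golden_powers (s * v); lra.
Qed.

Lemma golden_shift_reduce i k : exists m : {poly int}, (weight m <= 1)%N /\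
  exists b : int, phi ^+ i * phi ^- k = eval phi m + b%:~R * (2 - phi).
Proof.
have g0 := golden_neq0 R; have [ki|ik] := leqP k i.
  exists 'X^(i - k); rewrite weight_Xn; split=> //; exists 0.
  by rewrite mul0r addr0 evalXn -expfB_cond ?(negPf g0).
have [m [wm [b hb]]] := golden_negX (k - i).
exists m; split=> //; exists b; rewrite -hb.
rewrite -[in LHS](subnK (ltnW ik)) exprD invfM mulrC -mulrA mulVf ?mulr1 //.
exact: expf_neq0.
Qed.

(** Each monomial is reduced separately to one of weight at most 1, so the total weight cannot
    grow. *)
Lemma eval_shift_reduce q k : exists p, (weight p <= weight q)%N /\
  exists b : int, eval phi q * phi ^- k = eval phi p + b%:~R * (2 - phi).
Proof.
rewrite eval_coef mulr_suml (weight_widen (leqnn (size q))).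
elim: (size q) => [|n [p [wp [b hb]]]].
  exists 0; rewrite !big_ord0 /weight polyseq0 big_nil; split=> //.
  by exists 0; rewrite eval0 mul0r addr0.
have [m [wm [c hc]]] := golden_shift_reduce n k.
exists (p + q`_n *: m); split.
  rewrite big_ord_recr /= (leq_trans (weight_add _ _)) // leq_add // weightZ.
  by rewrite -[leqRHS]muln1 leq_mul2l wm orbT.
exists (b + q`_n * c); rewrite big_ord_recr /= hb -mulrA hc evalD evalZ.
rewrite rmorphD rmorphM /=.
by move: (q`_n)%:~R b%:~R c%:~R => x y z; lra.
Qed.

Lemma F_min_beta_min p : F_min p -> beta_min R p.
Proof.
move=> hp q m n h.
have [p' [wp' [b hb]]] := eval_shift_reduce (q * 'X^m) n.
rewrite -(weight_mulXn q m); apply: leq_trans wp'; apply: hp.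
apply/esym; apply: (@F_eval_eq R _ _ b); rewrite -hb evalMXn h.
by rewrite -mulrA divff ?mulr1 // expf_neq0 // golden_neq0.
Qed.

(** The value of [x] is obtained from [y] by removing [s] and inserting [r] one position lower; the
    factor phi clears the resulting phi^-1. *)
Lemma beta_min_replace (x y : {poly int}) (s r : seq int) : beta_min R x ->
  (forall k, dominates y`_k s`_k) -> (weight r <= weight s)%N ->
  phi * (eval phi x - eval phi y) =
    eval phi (Poly r) - phi * eval phi (Poly s) :> R ->
  (weight x <= weight y)%N.
Proof.
move=> hx hs rs h.
have hy : (weight (y - Poly s)%R + weight (Poly s) = weight y)%N.
  by apply: weight_sub => i; rewrite coef_Poly.
have /hx wx : eval phi ((y - Poly s) * 'X^1 + Poly r) * phi ^+ 0
    = eval phi x * phi ^+ 1.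
  rewrite evalD evalMXn evalB; move: h.
  by move: (eval _ (Poly r)) (eval _ (Poly s)) (eval _ x) (eval _ y) => *; lra.
rewrite -hy (leq_trans wx) // (leq_trans (weight_add _ _)) //.
by rewrite weight_mulXn !weight_Poly leq_add2l.
Qed.

Lemma weight_le_shifted (x y : {poly int}) (t : int) :
  beta_min R x -> beta_min R y -> (forall i, -1 <= x`_i <= 1) -> 0 <= t ->
  eval phi x = eval phi y + t%:~R * (2 - phi) :> R ->
  eval psi x = eval psi y + t%:~R * (phi + 1) :> R -> (weight x <= weight y)%N.
Proof.
move=> hx hy xd t0 e1 e2; have g := golden_sqr R.
have /andP[b1 b2] := golden_bounds R.
have sy := beta_min_sparse hy.
have /andP[y1 y2] := sparse_conj_bound R sy.
have /andP[_] := @conj_bound R 1 x isT (beta_min_sparse hx) xd.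
rewrite (_ : 1%:~R = 1) // addrK => x2.
(* For t >= 2, x(psi) > - (phi + 1) + 2 (phi + 1) = phi + 1, beyond the bound phi. *)
have [t2|t2] := lerP 2 t.
  have : 2 <= t%:~R :> R by rewrite (_ : 2 = 2%:~R) // ler_int.
  move=> t2R; have T : 2 * (phi + 1) <= t%:~R * (phi + 1).
    by rewrite ler_pM2r //; lra.
  exfalso; move: T e2 y1 x2.
  move: (eval psi x) (eval psi y) (t%:~R * _) => px py T T1 T2 T3 T4.
  by clear - T1 T2 T3 T4 b1; lra.
have [te|te] : t = 0 \/ t = 1 by lia.
  by apply: (hx y 0%N 0%N); rewrite !expr0 !mulr1 e1 te mul0r addr0.
move: e1 e2; rewrite te !mul1r => e1 e2.
(* - 1 + phi^-2 = - phi^-1 *)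
have [y0|y0] := ltrP y`_0 0.
  apply: (@beta_min_replace x y [:: -1] [:: -1]) => //.
    case=> [|k] /=; last by rewrite nth_nil; exact: dominates0.
    by move: (y`_0) y0 => a a0; rewrite /dominates; lia.
  by rewrite e1 !eval_Poly /=; move: (eval _ _) => *; lra.
(* 2 phi + phi^-2 = phi^2 + 1 *)
have [y12|y12] := lerP 2 y`_1.
  apply: (@beta_min_replace x y [:: 0; 2] [:: 0; 1; 0; 1]) => //.
  - case=> [|[|k]] /=; last by rewrite nth_nil; exact: dominates0.
      exact: dominates0.
    by move: (y`_1) y12 => a a0; rewrite /dominates; lia.
  - by rewrite /weight !big_cons !big_nil.
  rewrite e1 !eval_Poly /=; have [g2 g3 _ _ _] := golden_powers R.
  by move: (eval _ _) => *; lra.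
have y11 : y`_1 <= 1 by move: (y`_1) y12 => a; lia.
(* Now x(psi) = y(psi) + phi + 1 > phi, a contradiction. *)
have gy := eval_conj_gt R sy y0 y11.
exfalso; move: gy e2 x2; move: (eval psi x) (eval psi y) => px py T1 T2 T3.
by clear - T1 T2 T3; lra.
Qed.

Lemma beta_min_F_min (x : {poly int}) :
  beta_min R x -> (forall i, -1 <= x`_i <= 1) -> F_min x.
Proof.
move=> hx xd y; have [n] := ubnP (weight y).
elim: n y => // n IH y yn yx; have [//|yx'] := leqP (weight x) (weight y).
(* By induction, everything equivalent to and lighter than [y] weighs at least as much as [x], hence
   more than [y]; so [y] is F-minimal. *)
have hy : F_min y.
  move=> z zy; have [//|zy'] := leqP (weight y) (weight z).
  have xz : (weight x <= weight z)%N by apply: IH; rewrite ?zy //; lia.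
  by lia.
suff : (weight x <= weight y)%N by rewrite leqNgt yx'.
have [t [e1 e2]] := F_eval_eqP R (esym yx).
have [t0|t0] := lerP 0 t.
  exact: (weight_le_shifted hx (F_min_beta_min hy) xd t0 e1 e2).
rewrite -(weightN x) -(weightN y).
apply: (@weight_le_shifted (- x) (- y) (- t)).
- exact: beta_minN.
- exact/beta_minN/F_min_beta_min.
- by move=> i; rewrite coefN; move: (x`_i) (xd i) => a; lia.
- by lia.
- by rewrite !evalN e1 rmorphN mulNr opprD.
by rewrite !evalN e2 rmorphN mulNr opprD.
Qed.

End MinimalWeight.

(** * From polynomials back to words *)

Lemma minimal_weight_F_min (x : word) :
  minimal_weight F_equiv x <-> F_min (Poly (rev x)).
Proof.
split=> [hx q hq|hx [y [hxy]]].
  have [//|wq] := leqP (weight (Poly (rev x))) (weight q); exfalso; apply: hx.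
  exists (rev q); split.
    by rewrite /F_equiv !F_value_eval revK polyseqK.
  by rewrite -weight_Poly_rev revK polyseqK -(weight_Poly_rev x).
rewrite ltnNge => /negP; apply.
rewrite -(weight_Poly_rev x) -(weight_Poly_rev y).
by apply: hx; rewrite -!F_value_eval.
Qed.

Section BetaWords.
Variable R : realType.
Notation phi := (golden_ratio R).

Lemma beta_value_eval (x : word) :
  beta_value phi x = eval phi (Poly (rev x)) * phi ^- size x.
Proof.
have g0 := golden_neq0 R.
rewrite eval_coef.
rewrite -(@sum_coef_rev R (fun a : int => a%:~R) (fun i => phi ^+ i)) //.
rewrite /beta_value mulr_suml; apply: eq_bigr => i _.
rewrite -mulrA; congr (_ * _).
have -> : phi ^+ size x = phi ^+ (size x - i.+1) * phi ^+ i.+1.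
  by rewrite -exprD subnK.
rewrite invfM mulrA divff ?mul1r //.
exact: expf_neq0.
Qed.

Lemma minimal_weight_beta_min (x : word) :
  minimal_weight (beta_equiv phi) x <-> beta_min R (Poly (rev x)).
Proof.
have g0 := golden_neq0 R.
split=> [hx q m n h|hx [y [[k]]]].
  have [//|wq] := leqP (weight (Poly (rev x))) (weight q); exfalso; apply: hx.
  exists (rev q); split; last first.
    by rewrite -weight_Poly_rev revK polyseqK -(weight_Poly_rev x).
  (* The sizes enter because [beta_value] divides the value of the reversed word by phi to its
     length. *)
  exists (m%:Z - n%:Z + (size (rev q))%:Z - (size x)%:Z).
  rewrite !beta_value_eval revK polyseqK !expfzDr // -!exprnP -!exprnN.
  have fn j : phi ^+ j != 0 by exact: expf_neq0.
  have -> : eval phi (Poly (rev x)) = eval phi q * phi ^+ m * phi ^- n.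
    by rewrite h mulfK.
  have := divff (fn (size (rev q))).
  move: (phi ^- size (rev q)) (phi ^- size x) (phi ^- n) => b e d.
  move: (phi ^+ size (rev q)) (phi ^+ m) (eval _ _) => a c z ab.
  have -> : c * d * a * e * (z * b) = a * b * (c * d * e * z) by lra.
  by rewrite ab; lra.
rewrite !beta_value_eval => h; rewrite ltnNge => /negP; apply.
rewrite -(weight_Poly_rev x) -(weight_Poly_rev y).
have fn j : phi ^+ j != 0 by exact: expf_neq0.
have h' : eval phi (Poly (rev x)) * phi ^+ size y =
    phi ^ k * eval phi (Poly (rev y)) * phi ^+ size x.
  have /(congr1 (fun z => z * phi ^+ size x * phi ^+ size y)) := h.
  rewrite mulfVK // => ->; rewrite -!mulrA; congr (_ * (_ * _)).
  by rewrite mulrCA mulVf ?mulr1.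
(* A negative exponent is moved to the other side, as [beta_min] takes natural exponents. *)
case: k h h' => k _ h'.
  apply: (hx _ (k + size x)%N (size y)).
  by rewrite h' -exprnP exprD mulrCA mulrA.
apply: (hx _ (size x) (k.+1 + size y)%N).
by rewrite exprD mulrCA h' NegzE -exprnN -!mulrA mulVKf.
Qed.

End BetaWords.

Theorem mainTheorem10 (R : realType) :
  (minimal_weight F_equiv `&` signed_words)%classic =
  (minimal_weight (beta_equiv (golden_ratio R)) `&` signed_words)%classic.
Proof.
apply/seteqP; split=> x [hx sx]; split=> //.
  by apply/minimal_weight_beta_min/F_min_beta_min/minimal_weight_F_min.
apply/minimal_weight_F_min; apply: (@beta_min_F_min R).
  exact/minimal_weight_beta_min.
move=> i; rewrite coef_Poly; have [ix|ix] := ltnP i (size (rev x)).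
  have /(sx _) : (rev x)`_i \in x by rewrite -mem_rev mem_nth.
  by rewrite !inE => /or3P[] /eqP->.
by rewrite nth_default.
Qed.
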